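(* Let $k\ge 2$ be an integer, and define \[ u_k = \frac{2\log k}{\log k - \log(k-1)} . \] Then $u_k<(2k-1)\log k$. Moreover, for every fixed integer $d \ge u_k$, asymptotically almost surely (as $n\to\infty$) a random $n$-lift $L_n(K_{d+1})$ of the complete graph $K_{d+1}$ is not $k$-colourable.
   Context: $\log$ is the natural logarithm. Random lifts: given a fixed loopless multigraph $G=(V,E)$, a random $n$-lift $L_n(G)$ of $G$ is the random graph with vertex set $V\times[n]$ obtained as follows: each $v\in V$ is replaced by the fiber $\{v\}\times[n]$ and, independently for each edge $e\in E$ with endpoints $v,v'$, one adds a uniformly random perfect matching between the fibers of $v$ and $v'$ (so there are $n!^{|E|}$ equally likely lifts; parallel edges of $G$ contribute independent matchings). A graph is $k$-colourable if its vertices can be coloured with $k$ colours so that adjacent vertices receive different colours. A sequence of events $E_n$ holds asymptotically almost surely if $\Pr(E_n)\to1$ as $n\to\infty$. *)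

(* Defs.v *)
From mathcomp Require Import all_boot all_order all_algebra all_fingroup.
From mathcomp Require Import all_classical all_reals all_analysis.
Import Order.TTheory GRing.Theory Num.Theory.
Import numFieldNormedType.Exports.

Set Implicit Arguments.
Unset Strict Implicit.
Unset Printing Implicit Defensive.

Local Open Scope classical_set_scope.
Local Open Scope ring_scope.

(* The orientation of an edge from [src] to [tgt] is a bookkeeping device:
   adjacency below is symmetric in the two endpoints. *)
Record multigraph := Multigraph {
  vertex : finType;
  edge : finType;
  src : edge -> vertex;
  tgt : edge -> vertex;
  loopless : forall e, src e != tgt e
}.

Definition adj (G : multigraph) (x y : vertex G) : bool :=
  [exists e : edge G,
     ((src e == x) && (tgt e == y)) || ((src e == y) && (tgt e == x))].

Definition colourable (k : nat) (G : multigraph) : bool :=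
  [exists c : {ffun vertex G -> 'I_k},
     [forall x, forall y, adj x y ==> (c x != c y)]].

Definition complete_edge (m : nat) : finType :=
  {e : 'I_m * 'I_m | (e.1 < e.2)%N}.

Lemma complete_loopless (m : nat) (e : complete_edge m) :
  (val e).1 != (val e).2.
Proof. by rewrite -(inj_eq val_inj) neq_ltn (valP e). Qed.

Definition complete_graph (m : nat) : multigraph :=
  Multigraph (@complete_loopless m).

Lemma adj_complete (m : nat) (x y : vertex (complete_graph m)) :
  adj x y = (x != y).
Proof.
apply/existsP/idP => [[e /orP[]/andP[/eqP <- /eqP <-]]|].
- exact: complete_loopless.
- by rewrite eq_sym; exact: complete_loopless.
rewrite -(inj_eq val_inj) neq_ltn => /orP[] xy.
- by exists (Sub (x, y) xy); rewrite /= !eqxx.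
- by exists (Sub (y, x) xy); rewrite /= !eqxx orbT.
Qed.

(* A perfect matching between the fibers of [src e] and [tgt e] is encoded by
   the permutation [s] for which (src e, i) is matched with (tgt e, s i). *)
Definition matchings (G : multigraph) (n : nat) : finType :=
  {ffun edge G -> 'S_n}.

Lemma card_matchings (G : multigraph) (n : nat) :
  #|matchings G n| = (n`! ^ #|edge G|)%N.
Proof. by rewrite card_ffun card_Sn. Qed.

Section Lift.
Variables (G : multigraph) (n : nat) (s : matchings G n).

Definition lift_src (e : edge G * 'I_n) : vertex G * 'I_n := (src e.1, e.2).
Definition lift_tgt (e : edge G * 'I_n) : vertex G * 'I_n :=
  (tgt e.1, s e.1 e.2).

Lemma lift_loopless e : lift_src e != lift_tgt e.
Proof. by rewrite xpair_eqE negb_and loopless. Qed.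

Definition lift_graph : multigraph := Multigraph lift_loopless.

End Lift.

Definition lift_prob (R : realType) (G : multigraph) (n : nat)
    (P : pred multigraph) : R :=
  #|[pred s : matchings G n | P (lift_graph s)]|%:R / #|matchings G n|%:R.

Definition aas_lift (R : realType) (G : multigraph) (P : pred multigraph) :
    Prop :=
  lift_prob R G n P @[n --> \oo] --> (1 : R).

Definition u_threshold (R : realType) (k : nat) : R :=
  2 * ln k%:R / (ln k%:R - ln (k%:R - 1)).

(* Main.v *)
Require Import Defs.
From mathcomp Require Import all_boot all_order all_algebra all_fingroup.
From mathcomp Require Import all_classical all_reals all_analysis.
From mathcomp Require Import zify ring lra.
Import Order.TTheory GRing.Theory Num.Theory.
Import numFieldNormedType.Exports.

Set Implicit Arguments.
Unset Strict Implicit.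
Unset Printing Implicit Defensive.

(* For [k >= 3] the equality [d = u_k] is impossible, and a first moment bound
   over all families [A] of fibre colourings suffices.  Let [x_v] be the vector of
   colour frequencies in the fibre of [v].  A random matching between the fibres
   of [u] and [v] is proper with probability at most
     [poly(n) * (1 - <x_u, x_v>)^n
        <= poly(n) * ((1 - 1/k) * exp (k/(k-1) * (1/k - <x_u, x_v>)))^n].
   Summed over the edges of [K_{d+1}], the exponents are at most
   [n/2 * k/(k-1) * sum_v (|x_v|^2 - 1/k)], because [|sum_v x_v|^2 >= (d+1)^2/k].
   So the expected number of proper colourings factorises over the vertices, and
   [(k |x|^2 - 1) / (2 (k-1)) <= ln k - H(x)] makes each factor at most
   [k^n * poly(n)].  The total is
   [poly(n) * ((1 - 1/k)^(d/2) * k)^(n (d+1))], which vanishes when [d > u_k].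

   For [k = 2] we have [u_2 = 2], where the expected number of colourings does not
   tend to [0].  Composing the three matchings over a triangle of [K_{d+1}] gives a
   uniform permutation; in a 2-colourable lift it maps some set to its complement,
   which has probability at most [1 / sqrt (n + 1)]. *)

(** * Permutations mapping a set to its complement *)

(** When [p] is supported on [S], this says that every cycle of [p] on [S] has even length: [A]
    takes every second point of each cycle. *)
Definition reverses_cut (T : finType) (S : {set T}) (p : {perm T}) : bool :=
  [exists A : {set T}, [forall (x | x \in S), (p x \in A) == (x \notin A)]].

Lemma reverses_cutP (T : finType) (S : {set T}) (p : {perm T}) :
  reflect (exists A : {set T}, {in S, forall x, (p x \in A) = (x \notin A)})
          (reverses_cut S p).
Proof.
apply: (iffP existsP) => -[A].
  by move=> /forall_inP h; exists A => x xS; apply/eqP/h.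
by move=> h; exists A; apply/forall_inP => x xS; apply/eqP/h.
Qed.

Lemma card_bigcup_leq (I T : finType) (P : {pred I}) (F : I -> {set T}) (M : nat) :
  (forall i, i \in P -> #|F i| <= M) -> #|\bigcup_(i in P) F i| <= #|P| * M.
Proof.
move=> hM; rewrite -sum_nat_const.
elim/big_ind2: _ => [|n A m B hA hB|i /hM //]; first by rewrite cards0.
by rewrite (leq_trans (leq_card_setU _ _)) ?leq_add.
Qed.

(* Contract the path [z -> p z -> p (p z)] in the cycle through [z]. *)
Lemma card_reverses_cut_step (T : finType) (S : {set T}) (z : T) (M : nat) :
  z \in S ->
  (forall j, j \in S :\ z ->
     #|[set p | perm_on (S :\ z :\ j) p & reverses_cut (S :\ z :\ j) p]| <= M) ->
  #|[set p | perm_on S p & reverses_cut S p]| <= #|S :\ z| * (#|S :\ z| * M).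
Proof.
move=> zS hM.
pose F j l := [set (p * tperm j l * tperm z j)%g | p in
  [set p | perm_on (S :\ z :\ j) p & reverses_cut (S :\ z :\ j) p]].
have sub : [set p | perm_on S p & reverses_cut S p] \subset
   \bigcup_(j in S :\ z) \bigcup_(l in S :\ z) F j l.
  apply/fintype.subsetP => p; rewrite inE => /andP[pS /reverses_cutP[A hA]].
  have nfix x : x \in S -> p x != x.
    by move=> xS; apply/eqP => e; have := hA _ xS; rewrite e; case: (x \in A).
  pose j := p z.
  have jS : j \in S by rewrite /j (perm_closed _ pS).
  have jz : j != z by exact: nfix.
  pose q := (p * tperm z j)%g.
  have qz : q z = z by rewrite permM tpermR.
  have qS : perm_on S q.
    apply: perm_onM pS _; apply/fintype.subsetP => x; rewrite inE.
    by case: tpermP => [->|->|]; rewrite ?zS ?jS ?eqxx.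
  (* [l] is [p (p z)], except when [p] swaps [z] and [j]; then [l = j] and the second transposition
     is trivial. *)
  pose l := q j.
  have lz : l != z by rewrite /l -[X in _ != X]qz (inj_eq perm_inj).
  have lS : l \in S by rewrite /l (perm_closed _ qS).
  have jSz : j \in S :\ z by rewrite !inE jz.
  apply/bigcupP; exists j => //; apply/bigcupP; exists l; first by rewrite !inE lz.
  pose r := (q * tperm j l)%g.
  have rj : r j = j by rewrite permM tpermR.
  have rz : r z = z by rewrite permM qz tpermD // eq_sym.
  apply/imsetP; exists r; last first.
    by rewrite /r /q -!mulgA (mulgA (tperm j l)) tperm2 mul1g tperm2 mulg1.
  rewrite inE; apply/andP; split.
    apply/fintype.subsetP => x; rewrite inE => rx.
    have xz : x != z by apply: contraNneq rx => ->; rewrite rz.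
    have xj : x != j by apply: contraNneq rx => ->; rewrite rj.
    rewrite !inE xz xj /=; apply: contraNT rx => xS.
    rewrite permM (out_perm qS) // tpermD //.
      by rewrite eq_sym.
    by apply: contraNneq xS => <-.
  apply/reverses_cutP; exists A => x; rewrite !inE => /and3P[xj xz xS].
  rewrite -(hA x xS) /r permM.
  have pxj : p x != j by rewrite /j (inj_eq perm_inj).
  have qxl : q x != l by rewrite /l (inj_eq perm_inj).
  (* Only the predecessor of [z] gets a new image, namely [p j]. Two steps along the cycle preserve
     the side of [A], so the same [A] serves for [r]. *)
  move: qxl; rewrite {1 2}/q permM; case: tpermP => [pxz _|/eqP|_ _ qxl].
  - rewrite tpermL pxz.
    have pjz : p j != z by rewrite -pxz (inj_eq perm_inj) eq_sym.
    rewrite /l /q permM tpermD; last by rewrite eq_sym nfix.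
      by rewrite (hA j jS) /j (hA z zS) negbK.
    by rewrite eq_sym.
  - by rewrite (negbTE pxj).
  - by rewrite tpermD // eq_sym.
apply: leq_trans (subset_leq_card sub) _.
apply: card_bigcup_leq => j jSz; apply: card_bigcup_leq => l _.
exact: leq_trans (leq_imset_card _ _) (hM j jSz).
Qed.

(** Induction removing two points at a time. The contraction costs a factor [(m+1)^2], the factorial
    gains [(m+1)(m+2)], and the bound [1/sqrt(|S|+1)] on the proportion survives because
    [(m+1)(m+3) <= (m+2)^2]. Squaring keeps everything in the natural numbers. *)
Lemma card_reverses_cut (T : finType) (S : {set T}) :
  #|[set p | perm_on S p & reverses_cut S p]| ^ 2 * #|S|.+1 <= (#|S|)`! ^ 2.
Proof.
have [n] := ubnP #|S|; elim: n S => // n IHn S; rewrite ltnS => Sn.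
have [->|[z zS]] := set_0Vmem S.
  rewrite cards0 muln1 fact0 leq_sqr.
  have <- : #|@perm_on T finset.set0| = 1 by rewrite card_perm cards0.
  by apply: subset_leq_card; apply/fintype.subsetP => p; rewrite inE => /andP[].
(* On a single point the permutation has a fixed point, so the count is zero. *)
have [Sz|[w wS]] := set_0Vmem (S :\ z).
  have := @card_reverses_cut_step T S z 0 zS.
  rewrite Sz cards0 muln0 leqn0 => /(_ _)/eqP->; rewrite ?exp0n // => j.
  by rewrite inE.
have cS : #|S| = #|S :\ z|.+1 by rewrite (cardsD1 z) zS.
have cj j : j \in S :\ z -> #|S :\ z| = #|S :\ z :\ j|.+1.
  by move=> jS; rewrite (cardsD1 j) jS.
pose m := #|S :\ z :\ w|.
have hm j : j \in S :\ z -> #|S :\ z :\ j| = m.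
  by move=> jS; apply/eqP; rewrite -eqSS -!cj.
have [M hM eM] : exists2 M, (forall j, j \in S :\ z ->
     #|[set p | perm_on (S :\ z :\ j) p & reverses_cut (S :\ z :\ j) p]| <= M)
   & M ^ 2 * m.+1 <= m`! ^ 2.
  exists (\max_(j in S :\ z)
     #|[set p | perm_on (S :\ z :\ j) p & reverses_cut (S :\ z :\ j) p]|).
    by move=> j jS; exact: leq_bigmax_cond.
  have [|j jS ->] := @eq_bigmax_cond _ [in S :\ z] (fun j =>
     #|[set p | perm_on (S :\ z :\ j) p & reverses_cut (S :\ z :\ j) p]|).
    by apply/card_gt0P; exists w.
  rewrite -(hm j jS); apply: IHn.
  by rewrite (hm j jS) -/m; move: Sn; rewrite cS (cj w wS) -/m; apply: ltnW.
have := card_reverses_cut_step zS hM.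
rewrite cS (cj w wS) -/m -leq_sqr => h.
rewrite -(leq_pmul2r (ltn0Sn m)).
apply: (@leq_trans ((m.+1 * (m.+1 * M)) ^ 2 * m.+3 * m.+1)).
  by rewrite !leq_mul2r h !orbT.
rewrite !factS !expnMn.
apply: (@leq_trans (m.+1 ^ 2 * m.+1 ^ 2 * m.+3 * m`! ^ 2)).
  rewrite [leqLHS](_ : _ = m.+1 ^ 2 * m.+1 ^ 2 * m.+3 * (M ^ 2 * m.+1)); last by lia.
  by rewrite leq_mul2l eM orbT.
rewrite [leqRHS](_ : _ = m.+1 ^ 2 * (m.+2 ^ 2 * m.+1) * m`! ^ 2); last by lia.
rewrite leq_mul2r -mulnA leq_mul2l; apply/orP; right; apply/orP; right.
by nia.
Qed.

(** * Matchings between coloured fibres *)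

Definition class_size (T K : finType) (b : T -> K) (c : K) : nat :=
  #|[set x | b x == c]|.

Lemma sum_class_size (T K : finType) (b : T -> K) :
  \sum_c class_size b c = #|T|.
Proof.
rewrite -sum1_card (partition_big b xpredT) //=; apply: eq_bigr => c _.
by rewrite /class_size -sum1_card; apply: eq_bigl => x; rewrite inE.
Qed.

Lemma prod_class_size (T K : finType) (b : T -> K) (F : K -> nat) :
  \prod_x F (b x) = \prod_c F c ^ class_size b c.
Proof.
rewrite (partition_big b xpredT) //=; apply: eq_bigr => c _.
rewrite -prod_nat_const; apply: eq_big => x; first by rewrite inE.
by move=> /eqP->.
Qed.

(** Induction on [S]: the image of [z] lies in its own colour class within [S], and composing with a
    transposition that returns it to [z] leaves a stabilising permutation supported on [S :\ z]. *)
Lemma card_colour_stabiliser (T K : finType) (b : T -> K) (S : {set T}) :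
  #|[set s : {perm T} | perm_on S s & [forall x, b (s x) == b x]]|
    <= \prod_c (#|[set x in S | b x == c]|)`!.
Proof.
have [n] := ubnP #|S|; elim: n S => // n IHn S; rewrite ltnS => Sn.
have [->|[z zS]] := set_0Vmem S.
  rewrite (@leq_trans 1) //; last first.
    by rewrite big1 // => c _; rewrite (_ : [set x in _ | _] = finset.set0) ?cards0 //;
       apply/setP => x; rewrite !inE.
  have <- : #|@perm_on T finset.set0| = 1 by rewrite card_perm cards0.
  by apply: subset_leq_card; apply/fintype.subsetP => p; rewrite inE => /andP[].
pose B := [set x in S | b x == b z].
pose H := [set s : {perm T} | perm_on (S :\ z) s & [forall x, b (s x) == b x]].
have sub : [set s : {perm T} | perm_on S s & [forall x, b (s x) == b x]]
    \subset \bigcup_(j in B) [set (s * tperm z j)%g | s in H].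
  apply/fintype.subsetP => s; rewrite inE => /andP[sS /forallP sb].
  apply/bigcupP; exists (s z); first by rewrite inE (perm_closed _ sS) zS sb.
  pose q := (s * tperm z (s z))%g.
  have qz : q z = z by rewrite permM tpermR.
  apply/imsetP; exists q; last by rewrite /q -mulgA tperm2 mulg1.
  rewrite inE; apply/andP; split.
    apply/fintype.subsetP => x; rewrite inE => qx.
    have xz : x != z by apply: contraNneq qx => ->; rewrite qz.
    rewrite !inE xz /=; apply: contraNT qx => xS.
    rewrite permM (out_perm sS xS) tpermD // 1?eq_sym //.
    by apply: contraNneq xS => ->; rewrite (perm_closed _ sS).
  apply/forallP => x; rewrite permM -(eqP (sb x)).
  by case: tpermP => [->|->|//]; rewrite ?(eqP (sb z)).
apply: leq_trans (subset_leq_card sub) _.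
apply: (@leq_trans (#|B| * #|H|)).
  by apply: card_bigcup_leq => j _; exact: leq_imset_card.
rewrite (bigD1 (b z)) //=.
have zB : z \in B by rewrite inE zS /=.
rewrite (cardsD1 z) zB add1n factS -mulnA leq_pmul2l //.
apply: leq_trans (IHn (S :\ z) _) _.
  by move: Sn; rewrite (cardsD1 z) zS.
rewrite (bigD1 (b z)) //= leq_mul //.
  rewrite (_ : [set x in S :\ z | _] = B :\ z) //.
  by apply/setP => x; rewrite !inE andbA.
apply: leq_prod => c cz; rewrite (_ : [set x in S :\ z | _] = [set x in S | b x == c]) //.
apply/setP => x; rewrite !inE; case: eqP => [->|//].
by rewrite [b z == c]eq_sym (negbTE cz) !andbF.
Qed.

(** The set is empty or a translate, by any of its elements [t], of a subset of the stabiliser of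
    [b]. *)
Lemma card_perm_recolour (T K : finType) (b b' : T -> K) :
  #|[set s : {perm T} | [forall x, b (s x) == b' x]]|
    <= \prod_c (class_size b c)`!.
Proof.
have [->|[t]] := set_0Vmem [set s : {perm T} | [forall x, b (s x) == b' x]].
  by rewrite cards0.
rewrite inE => /forallP tb.
apply: leq_trans (leq_trans (card_colour_stabiliser b finset.setT) _); last first.
  apply: leq_prod => c _; rewrite /class_size.
  rewrite (_ : [set x in finset.setT | _] = [set x | b x == c]) //.
  by apply/setP => x; rewrite !inE.
rewrite -(card_imset _ (mulgI t^-1%g)); apply: subset_leq_card.
apply/fintype.subsetP => u /imsetP[s]; rewrite [s \in _]inE => /forallP sb ->.
rewrite inE; apply/andP; split; first by apply/fintype.subsetP => x; rewrite inE.
by apply/forallP => x; rewrite permM (eqP (sb _)) -(eqP (tb _)) permKV.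
Qed.

(* Compare a uniform permutation with a uniform self-map [f] of [T] conditioned
   on [b \o f] having the same class sizes as [b]. *)
Lemma card_proper_perm (T K : finType) (a b : T -> K) :
  #|[set s : {perm T} | [forall x, a x != b (s x)]]|
      * \prod_c class_size b c ^ class_size b c
    <= \prod_c (class_size b c)`! * \prod_x (#|T| - class_size b (a x)).
Proof.
pose B := [set b' : {ffun T -> K} | [forall x, a x != b' x]
   & [forall c, class_size b' c == class_size b c]].
have sub : [set s : {perm T} | [forall x, a x != b (s x)]] \subset
    \bigcup_(b' in B) [set s : {perm T} | [forall x, b (s x) == b' x]].
  apply/fintype.subsetP => s; rewrite inE => /forallP sa.
  apply/bigcupP; exists [ffun x => b (s x)]; last first.
    by rewrite inE; apply/forallP => x; rewrite ffunE.
  rewrite inE; apply/andP; split; first by apply/forallP => x; rewrite ffunE.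
  apply/forallP => c; rewrite /class_size.
  rewrite -(card_imset [pred x | _] (@perm_inj _ s)) /=; apply/eqP/eq_card => y.
  rewrite !inE; apply/imsetP/idP => [[x]|bc].
    by rewrite !inE ffunE => bc ->.
  by exists (s^-1 y)%g; rewrite ?permKV // !inE ffunE permKV.
have le : #|[set s : {perm T} | [forall x, a x != b (s x)]]|
    <= #|B| * \prod_c (class_size b c)`!.
  apply: leq_trans (subset_leq_card sub) _.
  by apply: card_bigcup_leq => b' _; exact: card_perm_recolour.
apply: leq_trans (leq_mul le (leqnn _)) _.
rewrite mulnAC mulnC leq_mul2l; apply/orP; right.
rewrite -sum_nat_const.
(* The product over [x] counts the self-maps [f] with [b \o f = b']. Summed over all [b'] that avoid
   [a] pointwise, not only those in [B], it gives the right-hand side. *)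
rewrite [leqLHS](_ : _ = \sum_(b' in B) \prod_x class_size b (b' x)); last first.
  apply: eq_bigr => b'; rewrite inE => /andP[_ /forallP bb'].
  by rewrite (prod_class_size b'); apply: eq_bigr => c _; rewrite (eqP (bb' c)).
rewrite [leqRHS](_ : _ = \prod_x \sum_(c | a x != c) class_size b c); last first.
  apply: eq_bigr => x _; rewrite -(sum_class_size b) (bigD1 (a x)) //= addKn.
  by apply: eq_bigl => c; rewrite eq_sym.
rewrite bigA_distr_big_dep /=.
rewrite [leqRHS](bigID [in B]) /=.
apply: leq_trans (leq_addr _ _).
rewrite leq_eqVlt; apply/orP; left; apply/eqP; apply: eq_bigl => b'.
rewrite andb_idl // [b' \in B]inE => /andP[/forallP h _].
by apply/familyP => x; exact: h.
Qed.

(** Method of types: there are at most [(|T|+1)^|K|] vectors of class sizes. For a fixed vector, the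
    summands are among the terms in the expansion of [(\sum_c class_size a0 c) ^ |T| = |T| ^
    |T|]. *)
Lemma sum_prod_class_size (T K : finType) :
  \sum_(a : {ffun T -> K}) \prod_c class_size a c ^ class_size a c
    <= #|T|.+1 ^ #|K| * #|T| ^ #|T|.
Proof.
have lt (a : {ffun T -> K}) c : class_size a c < #|T|.+1.
  by rewrite ltnS max_card.
pose type (a : {ffun T -> K}) := [ffun c => Ordinal (lt a c)].
rewrite (partition_big type xpredT) //=.
have -> : #|T|.+1 ^ #|K| = #|{ffun K -> 'I_#|T|.+1}| by rewrite card_ffun card_ord.
rewrite -sum_nat_const; apply: leq_sum => t _.
have [/existsP[a0 /eqP ta0]|/existsPn no] := boolP [exists a, type a == t]; last first.
  by rewrite big_pred0 // => a; exact/negbTE.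
rewrite (eq_bigr (fun a : {ffun T -> K} => \prod_x class_size a0 (a x))); last first.
  move=> a /eqP ta; rewrite prod_class_size; apply: eq_bigr => c _.
  by have /ffunP/(_ c)/(congr1 val) := ta; rewrite -ta0 !ffunE /= => ->.
have -> : #|T| ^ #|T| = (\sum_c class_size a0 c) ^ #|T| by rewrite sum_class_size.
rewrite -prod_nat_const bigA_distr_bigA /=.
by rewrite [leqRHS](bigID (fun a => type a == t)) /= leq_addr.
Qed.

(** * Logarithm inequalities and crude Stirling bounds *)

Local Open Scope ring_scope.

(** The function [ln t + 4 / (t + 1)] has derivative [(t-1)^2 / (t (t+1)^2)] and value 2 at 1. The
    bound serves both the entropy estimate and the upper bound on [u_k]. *)
Lemma ln_gt_ratio (R : realType) (y : R) : 1 < y -> 2 * (y - 1) / (y + 1) < ln y.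
Proof.
move=> y1.
pose f (t : R) : R := ln t + 4 * (t + 1)^-1.
pose df (t : R) : R := (t - 1) ^+ 2 / (t * (t + 1) ^+ 2).
have hf (t : R) : 1 <= t -> is_derive t 1 f (df t).
  move=> t1.
  have t0 : 0 < t by lra.
  have tn : t + 1 != 0 by lra.
  have dl := is_derive1_ln t0.
  rewrite /f; apply: is_derive_eq.
  by rewrite /df /GRing.scale /=; field; lra.
have cf : {within `[1, y], continuous f}%classic.
  apply: derivable_within_continuous => t; rewrite in_itv /= => /andP[t1 _].
  exact: (@ex_derive _ _ _ _ _ _ _ (hf t t1)).
have [t|c] := @MVT R f df 1 y y1 _ cf.
  by rewrite in_itv /= => /andP[t1 _]; apply: hf; exact: ltW.
rewrite in_itv /= => /andP[c1 _] fE.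
have : 0 < f y - f 1.
  rewrite fE mulr_gt0 ?subr_gt0 // divr_gt0 ?exprn_gt0 ?subr_gt0 //.
  by rewrite mulr_gt0 ?exprn_gt0 //; lra.
rewrite /f ln1 subr_gt0 => h.
rewrite (_ : 2 * (y - 1) / (y + 1) = 2 - 4 / (y + 1)); last by field; lra.
by rewrite ltrBlDr; apply: le_lt_trans h; rewrite [leRHS](_ : _ = 2) //; field; lra.
Qed.

(** Pointwise form of the entropy estimate, with [z] equal to [k] times a frequency. Above 1,
    [ln_gt_ratio] gives the denominator [z + 1 <= k + 1]; below 1, a square root substitution gives
    the denominator 4. Both are at most [2 (k - 1)] exactly when [k >= 3]. *)
Lemma mulr_ln_ge (R : realType) (k z : R) : 3 <= k -> 0 <= z <= k ->
  (z - 1) + (z - 1) ^+ 2 / (2 * (k - 1)) <= z * ln z.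
Proof.
move=> k3 /andP[z0 zk].
have k1 : 0 < 2 * (k - 1) by lra.
have [z1|z1] := ltP 1 z.
  have h := ln_gt_ratio z1.
  have z1' : 0 < z + 1 by lra.
  apply: (@le_trans _ _ (z * (2 * (z - 1) / (z + 1)))); last first.
    by apply: ler_wpM2l => //; exact: ltW.
  rewrite [leRHS](_ : _ = (z - 1) + (z - 1) ^+ 2 / (z + 1)); last first.
    by field; lra.
  rewrite lerD2l ler_wpM2l ?sqr_ge0 // lef_pV2 ?posrE //; lra.
have [->|zn] := eqVneq z 0.
  rewrite mul0r sub0r sqrrN expr1n -lerBrDl sub0r opprK ler_pdivrMr //; lra.
have zp : 0 < z by rewrite lt_neqAle eq_sym zn.
(* Applying [ln y <= y - 1] to [1/s] instead of [1/z] gains the quadratic term [(s-1)^2], and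
   [(z-1)^2 = (s-1)^2 (s+1)^2 <= 4 (s-1)^2]. *)
pose s := Num.sqrt z.
have sp : 0 < s by rewrite sqrtr_gt0.
have s2 : s ^+ 2 = z by rewrite sqr_sqrtr.
have s1 : s <= 1 by rewrite -sqrtr1 ler_sqrt.
have h : ln s^-1 <= s^-1 - 1.
  have := @le_ln1Dx R (s^-1 - 1); rewrite subrKC; apply.
  by rewrite ltrBrDr addNr invr_gt0.
have hz : ln z = - (2 * ln s^-1).
  by rewrite -s2 lnXn // lnV ?posrE // mulrN opprK mulr_natl.
apply: (@le_trans _ _ ((z - 1) + (s - 1) ^+ 2)).
  rewrite lerD2l ler_pdivrMr //.
  have -> : z - 1 = (s - 1) * (s + 1) by rewrite -s2; ring.
  rewrite exprMn ler_wpM2l ?sqr_ge0 //.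
  apply: (@le_trans _ _ 4); last by lra.
  by rewrite [leRHS](_ : 4 = 2 ^+ 2 :> R); [apply: lerXn2r; rewrite ?nnegrE; lra | ring].
rewrite hz -s2.
have -> : s ^+ 2 - 1 + (s - 1) ^+ 2 = s ^+ 2 * (- (2 * (s^-1 - 1))).
  by field; lra.
by apply: ler_wpM2l; rewrite ?sqr_ge0 // lerN2 ler_pM2l.
Qed.

(** Stirling up to a polynomial factor. For positive [q] the induction gives the factor [q]; it is
    weakened to [q + 1] so that empty colour classes are covered. *)
Lemma fact_expR_le (R : realType) (q : nat) :
  q`!%:R * expR 1 ^+ q <= expR 1 * q.+1%:R * q%:R ^+ q :> R.
Proof.
have e1 : 1 <= expR 1 :> R by rewrite -expR0 ler_expR.
case: q => [|q]; first by rewrite fact0 !expr0 !mulr1.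
have h : (q.+1)`!%:R * expR 1 ^+ q <= q.+1%:R * q.+1%:R ^+ q.+1 :> R.
  elim: q => [|q IHq]; first by rewrite factS fact0 muln1 expr0 expr1.
  rewrite factS natrM exprS.
  rewrite -mulrA ler_pM2l ?ltr0n // mulrCA.
  apply: (@le_trans _ _ (expR 1 * (q.+1%:R * q.+1%:R ^+ q.+1))).
    by rewrite ler_wpM2l ?expR_ge0.
  rewrite -exprS.
  have q0 : (0 : R) < q.+1%:R by rewrite ltr0n.
  have h : q.+1%:R / q.+2%:R <= expR (- q.+2%:R^-1) :> R.
    apply: le_trans (expR_ge1Dx _).
    have q2 : (q.+2%:R : R) != 0 by rewrite pnatr_eq0.
    by move: q2; rewrite le_eqVlt -(natr1 q.+1) => q2; apply/orP; left; apply/eqP; field.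
  have {h} : (q.+1%:R / q.+2%:R) ^+ q.+2 <= expR (- q.+2%:R^-1) ^+ q.+2 :> R.
    by apply: lerXn2r => //; rewrite nnegrE ?expR_ge0 // divr_ge0.
  rewrite -expRM_natl mulrN divff ?pnatr_eq0 // expRN exprMn exprVn.
  by rewrite ler_pdivrMr ?exprn_gt0 ?ltr0n // ler_pdivlMl ?expR_gt0.
rewrite exprS mulrCA -mulrA ler_pM2l ?expR_gt0 //.
apply: le_trans h _; rewrite ler_wpM2r ?exprn_ge0 //.
by rewrite ler_nat.
Qed.

(** [n^n / n!] is one term of the series for [e^n]. *)
Lemma exprn_le_expR_fact (R : realType) (n : nat) :
  n%:R ^+ n <= expR 1 ^+ n * n`!%:R :> R.
Proof.
case: n => [|n]; first by rewrite !expr0 fact0 mulr1.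
have := @expR_ge1Dxn R n.+1%:R n (ler0n _ _).
move=> h; have {h} : n.+1%:R ^+ n.+1 / (n.+1)`!%:R <= expR n.+1%:R :> R.
  by apply: le_trans h; rewrite lerDr.
rewrite ler_pdivrMr ?ltr0n ?fact_gt0 //.
by rewrite -{2}[n.+1%:R]mulr1 expRM_natl.
Qed.

(** * Colour frequencies and the entropy bound *)

Definition frequency (R : realType) (T K : finType) (a : T -> K) (c : K) : R :=
  (class_size a c)%:R / #|T|%:R.

Lemma sum_frequency (R : realType) (T K : finType) (a : T -> K) :
  (0 < #|T|)%N -> \sum_c frequency R a c = 1.
Proof.
move=> T0; rewrite -mulr_suml -natr_sum sum_class_size divff //.
by rewrite pnatr_eq0 -lt0n.
Qed.

Lemma sum_comp_frequency (R : realType) (T K : finType) (a : T -> K) (F : K -> R) :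
  (0 < #|T|)%N -> \sum_x F (a x) = #|T|%:R * \sum_c frequency R a c * F c.
Proof.
move=> T0; have Tn : #|T|%:R != 0 :> R by rewrite pnatr_eq0 -lt0n.
rewrite (partition_big a xpredT) //= mulr_sumr; apply: eq_bigr => c _.
rewrite (eq_bigr (fun=> F c)) => [|x /eqP-> //].
rewrite sumr_const /frequency mulrA mulrCA divff // mulr1 mulr_natl.
by congr (_ *+ _); rewrite /class_size; apply: eq_card => x; rewrite inE.
Qed.

Lemma prod_comp_frequency (R : realType) (T K : finType) (a : T -> K) (F : K -> R) :
  \prod_x F (a x) = \prod_c F c ^+ class_size a c.
Proof.
rewrite (partition_big a xpredT) //=; apply: eq_bigr => c _.
rewrite (eq_bigr (fun=> F c)) => [|x /eqP-> //].
by rewrite prodr_const; congr (_ ^+ _); apply: eq_card => x; rewrite inE.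
Qed.

Lemma prod_fact_class_size (R : realType) (T K : finType) (b : T -> K) :
  (\prod_c (class_size b c)`!)%N%:R * expR 1 ^+ #|T|
    <= (expR 1 * #|T|.+1%:R) ^+ #|K| *
       (\prod_c class_size b c ^ class_size b c)%N%:R :> R.
Proof.
rewrite !natr_prod -{1}(sum_class_size b) -prodrXr -prodr_const -!big_split /=.
apply: ler_prod => c _; rewrite mulr_ge0 ?exprn_ge0 ?expR_ge0 //=.
apply: le_trans (fact_expR_le R _) _.
rewrite natrX ler_wpM2r ?exprn_ge0 // ler_wpM2l ?expR_ge0 //.
by rewrite ler_nat ltnS max_card.
Qed.

(** The Stirling bounds reduce the count to the product of [1 - frequency R b (a x)] over [x]. Each
    factor is then compared with an exponential tangent to it at frequency [1/k], which makes the
    exponents add up to an inner product. *)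
Lemma card_proper_perm_le (R : realType) (T K : finType) (a b : T -> K) :
  (1 < #|K|)%N -> (0 < #|T|)%N ->
  #|[set s : {perm T} | [forall x, a x != b (s x)]]|%:R / ((#|T|)`!)%:R
    <= (expR 1 * #|T|.+1%:R) ^+ #|K| * (1 - #|K|%:R^-1) ^+ #|T| *
       expR (#|T|%:R * (#|K|%:R / (#|K|%:R - 1)) *
             (#|K|%:R^-1 - \sum_c frequency R a c * frequency R b c)) :> R.
Proof.
move=> K1 T0.
set N := #|_|%N; set n := #|T|; set k : R := #|K|%:R.
have n0 : 0 < n%:R :> R by rewrite ltr0n.
have k1 : 1 < k by rewrite ltr1n.
pose W := (\prod_c class_size b c ^ class_size b c)%N.
pose F := (\prod_c (class_size b c)`!)%N.
pose Q := (\prod_x (n - class_size b (a x)))%N.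
pose P : R := (expR 1 * n.+1%:R) ^+ #|K|.
have P0 : 0 <= P by rewrite exprn_ge0 // mulr_ge0 ?expR_ge0.
have W0 : 0 < W%:R :> R.
  by rewrite ltr0n prodn_gt0 // => c; case: (class_size b c) => // m; rewrite expn_gt0.
have hN : N%:R * W%:R <= F%:R * Q%:R :> R.
  by rewrite -!natrM ler_nat; exact: card_proper_perm.
have hF : F%:R * expR 1 ^+ n <= P * W%:R := prod_fact_class_size R b.
have hNP : N%:R * expR 1 ^+ n <= P * Q%:R.
  rewrite -(ler_pM2r W0) mulrAC.
  apply: le_trans (ler_wpM2r (exprn_ge0 _ (expR_ge0 1)) hN) _.
  by rewrite mulrAC [leRHS]mulrAC ler_wpM2r.
have hn := exprn_le_expR_fact R n.
have f0 : 0 < (n`!)%:R :> R by rewrite ltr0n fact_gt0.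
have nn0 : 0 < n%:R ^+ n :> R by rewrite exprn_gt0.
apply: (@le_trans _ _ (P * (Q%:R / n%:R ^+ n))).
  rewrite ler_pdivrMr // mulrA mulrAC ler_pdivlMr //.
  apply: le_trans (ler_wpM2l (ler0n _ N) hn) _.
  by rewrite mulrA ler_wpM2r ?ler0n.
rewrite -mulrA ler_wpM2l //.
have -> : Q%:R / n%:R ^+ n = \prod_x (1 - frequency R b (a x)).
  have <- : \prod_(x : T) (n%:R : R) = n%:R ^+ n by rewrite prodr_const.
  rewrite natr_prod -prodf_div.
  apply: eq_bigr => x _; rewrite natrB ?max_card // mulrBl divff //.
  by rewrite gt_eqF.
have -> : (1 - k^-1) ^+ n * expR (n%:R * (k / (k - 1)) *
     (k^-1 - \sum_c frequency R a c * frequency R b c)) =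
   \prod_x ((1 - k^-1) * expR ((k / (k - 1)) * (k^-1 - frequency R b (a x)))).
  rewrite big_split /= prodr_const -expR_sum -mulr_sumr sumrB sumr_const.
  rewrite sum_comp_frequency // -[k^-1 *+ _]mulr_natl -/n -mulrBr.
  by rewrite -[in LHS]mulrA [in LHS]mulrCA.
apply: ler_prod => x _; apply/andP; split.
  rewrite subr_ge0 ler_pdivrMr // mul1r ler_nat; exact: max_card.
(* [1 - y = (1 - 1/k) (1 + k/(k-1) (1/k - y))], followed by [1 + t <= e^t]. *)
apply: (@le_trans _ _ ((1 - k^-1) * (1 + (k / (k - 1)) * (k^-1 - frequency R b (a x))))).
  by rewrite le_eqVlt; apply/orP; left; apply/eqP; field; lra.
apply: ler_wpM2l (expR_ge1Dx _).
by rewrite subr_ge0 invf_le1 ?ltW //; lra.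
Qed.

(* The exponent is the quadratic approximation to the relative entropy of the
   frequencies with respect to the uniform distribution. *)
Lemma expR_frequency_le (R : realType) (T K : finType) (a : T -> K) :
  (3 <= #|K|)%N -> (0 < #|T|)%N ->
  expR (#|T|%:R * ((#|K|%:R * (\sum_c frequency R a c ^+ 2) - 1) / (2 * (#|K|%:R - 1))))
    <= \prod_c (#|K|%:R * frequency R a c) ^+ class_size a c.
Proof.
move=> K3 T0.
set n : R := #|T|%:R; set k : R := #|K|%:R.
have n0 : 0 < n by rewrite ltr0n.
have k3 : 3 <= k by rewrite ler_nat.
have k0 : 0 < k by lra.
pose z c := k * frequency R a c.
have f0 c : 0 <= frequency R a c by rewrite divr_ge0.
have f1 c : frequency R a c <= 1 by rewrite ler_pdivrMr // mul1r ler_nat max_card.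
have zc c : 0 <= z c <= k.
  by rewrite mulr_ge0 //= ler_piMr //; lra.
(* This is [exp (n (ln k - H))], with [H] the entropy of the frequencies. An empty class contributes
   1 on both sides. *)
have -> : \prod_c (k * frequency R a c) ^+ class_size a c =
    expR (n / k * \sum_c z c * ln (z c)).
  rewrite mulr_sumr expR_sum; apply: eq_bigr => c _.
  have [e|ne] := eqVneq (class_size a c) 0%N.
    by rewrite e expr0 /z /frequency e !mul0r mulr0 mul0r mulr0 expR0.
  have zp : 0 < z c by rewrite mulr_gt0 // divr_gt0 // ltr0n lt0n.
  rewrite -/(z c) -[in LHS](lnK zp) -expRM_natl; congr expR.
  rewrite mulrA; congr (_ * _).
  by rewrite /z /frequency -/n; field; apply/andP; split; lra.
rewrite ler_expR.
apply: (@le_trans _ _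
  (n / k * \sum_c ((z c - 1) + (z c - 1) ^+ 2 / (2 * (k - 1))))); last first.
  apply: ler_wpM2l; first by rewrite divr_ge0 ?ltW.
  by apply: ler_sum => c _; exact: mulr_ln_ge.
(* The [z c] have mean 1, so the linear terms cancel and only the quadratic ones remain. *)
have s1 : \sum_c z c = k by rewrite -mulr_sumr sum_frequency // mulr1.
have s2 : \sum_c (z c - 1) = 0 by rewrite sumrB s1 sumr_const subrr.
have s3 : \sum_c (z c - 1) ^+ 2 = k ^+ 2 * (\sum_c frequency R a c ^+ 2) - k.
  under eq_bigr do rewrite sqrrB1.
  rewrite big_split /= sumrB sumr_const -/k sumrMnl s1 mulr_sumr.
  rewrite (eq_bigr (fun c => k ^+ 2 * frequency R a c ^+ 2)); last first.
    by move=> c _; rewrite exprMn.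
  by ring.
rewrite big_split /= -mulr_suml s2 s3 add0r.
by rewrite le_eqVlt; apply/orP; left; apply/eqP; field; apply/andP; split; lra.
Qed.

(** Each summand is [(|K| / |T|) ^ |T|] times the weight bounded in [sum_prod_class_size]. *)
Lemma sum_prod_frequency_le (R : realType) (T K : finType) :
  (0 < #|T|)%N ->
  \sum_(a : {ffun T -> K}) \prod_c (#|K|%:R * frequency R a c) ^+ class_size a c
    <= #|K|%:R ^+ #|T| * #|T|.+1%:R ^+ #|K| :> R.
Proof.
move=> T0.
have n0 : 0 < #|T|%:R ^+ #|T| :> R by rewrite exprn_gt0 // ltr0n.
have e (a : {ffun T -> K}) :
  \prod_c (#|K|%:R * frequency R a c) ^+ class_size a c =
  #|K|%:R ^+ #|T| / #|T|%:R ^+ #|T| *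
    (\prod_c class_size a c ^ class_size a c)%N%:R :> R.
  rewrite -{1 2 3}(sum_class_size a) -!prodrXr -prodf_div natr_prod -big_split /=.
  apply: eq_bigr => c _; rewrite natrX /frequency mulrCA mulrC !exprMn exprVn.
  by rewrite sum_class_size.
under eq_bigr do rewrite e.
rewrite -mulr_sumr -natr_sum -mulrA ler_wpM2l ?exprn_ge0 //.
rewrite mulrC ler_pdivrMr // -!natrX -natrM ler_nat.
exact: sum_prod_class_size.
Qed.

(** * Lifts of complete graphs *)

Lemma colourable_liftP (k : nat) (G : multigraph) (n : nat) (s : matchings G n) :
  colourable k (lift_graph s) ->
  exists A : {ffun vertex G -> {ffun 'I_n -> 'I_k}},
    forall e i, A (src e) i != A (tgt e) (s e i).
Proof.
move=> /existsP[c /forallP hc].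
exists [ffun v => [ffun i => c (v, i)]] => e i; rewrite !ffunE.
have /forallP/(_ (tgt e, s e i))/implyP := hc (src e, i); apply.
by apply/existsP; exists (e, i); rewrite /= !eqxx.
Qed.

(** Union bound over [A]. For a fixed [A], the lifts properly coloured by [A] form a product set
    over the edges, since the matchings are independent. *)
Lemma lift_prob_colourable_le (R : realType) (k : nat) (G : multigraph) (n : nat) :
  lift_prob R G n (colourable k) <=
  \sum_(A : {ffun vertex G -> {ffun 'I_n -> 'I_k}}) \prod_(e : edge G)
    (#|[set s : 'S_n | [forall i, A (src e) i != A (tgt e) (s i)]]|%:R / (n`!)%:R).
Proof.
pose F (A : {ffun vertex G -> {ffun 'I_n -> 'I_k}}) (e : edge G) :=
  [set s : 'S_n | [forall i, A (src e) i != A (tgt e) (s i)]].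
have f0 : 0 < (#|matchings G n|)%:R :> R.
  by rewrite ltr0n card_matchings expn_gt0 fact_gt0.
rewrite /lift_prob ler_pdivrMr // mulr_suml.
rewrite (eq_bigr (fun A => (\prod_e #|F A e|)%N%:R)); last first.
  move=> A _; rewrite card_matchings natrX -prodr_const -big_split natr_prod /=.
  by apply: eq_bigr => e _; rewrite -mulrA mulVf ?mulr1 // pnatr_eq0 -lt0n fact_gt0.
rewrite -natr_sum ler_nat.
rewrite (eq_bigr (fun A => #|[set s : matchings G n | s \in family (F A)]|)); last first.
  move=> A _; rewrite cardsE card_family foldrE big_map big_enum /=.
  by apply: eq_bigr.
apply: (@leq_trans #|\bigcup_A [set s : matchings G n | s \in family (F A)]|).
  apply: subset_leq_card; apply/fintype.subsetP => s /colourable_liftP[A hA].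
  apply/finset.bigcupP; exists A => //; rewrite inE; apply/familyP => e.
  by rewrite inE; apply/forallP => i; exact: hA.
elim/big_ind2: _ => [|a X b Y hX hY|A _ //]; first by rewrite cards0.
by rewrite (leq_trans (leq_card_setU _ _)) ?leq_add.
Qed.

(** Ordered pairs split into [u < v], [u > v] and the diagonal. Working in any [nmodType] lets this
    serve both for counting edges and for real sums. *)
Lemma sum_complete_edge (R : nmodType) (m : nat) (F : 'I_m -> 'I_m -> R) :
  (forall u v, F u v = F v u) ->
  (\sum_(e : edge (complete_graph m)) F (src e) (tgt e)) *+ 2 + \sum_u F u u
    = \sum_u \sum_v F u v.
Proof.
move=> Fsym.
have -> : \sum_(e : edge (complete_graph m)) F (src e) (tgt e) =
    \sum_(p : 'I_m * 'I_m | (p.1 < p.2)%N) F p.1 p.2.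
  rewrite (big_sub _ (fun p : 'I_m * 'I_m => F p.1 p.2)) /=.
  by [].
rewrite pair_big /= [RHS](bigID (fun p : 'I_m * 'I_m => (p.1 < p.2)%N)) /= mulr2n -addrA.
congr (_ + _).
rewrite [RHS](bigID (fun p : 'I_m * 'I_m => (p.2 < p.1)%N)) /=; congr (_ + _).
  rewrite [RHS](reindex_inj (h := fun p : 'I_m * 'I_m => (p.2, p.1))) /=; last first.
    by move=> [a b] [c d] [-> ->].
  by apply: eq_big => [p|p _ //]; case: ltngtP.
rewrite (eq_bigl (fun p : 'I_m * 'I_m => p.1 == p.2)); last first.
  by move=> p; rewrite -(inj_eq val_inj) /=; case: ltngtP.
rewrite -(pair_big_dep xpredT (fun u v => u == v) F) /=.
by apply: eq_bigr => u _; rewrite (big_pred1 u) // => v; rewrite eq_sym.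
Qed.

Lemma card_complete_edge (m : nat) : (#|edge (complete_graph m)| * 2 + m = m * m)%N.
Proof.
have := @sum_complete_edge nat m (fun _ _ => 1%N) (fun _ _ => erefl).
rewrite !sum_nat_const !card_ord !muln1 => <-; congr (_ + _)%N.
by rewrite muln2 -addnn.
Qed.

(** The sum over all ordered pairs is [m^2/k - \sum_c S c ^ 2], which is nonpositive by
    Cauchy-Schwarz because the [S c] add up to [m]. Twice the edge sum is therefore at most minus
    the diagonal sum. *)
Lemma sum_edge_disagreement_le (R : realType) (m : nat) (K : finType)
    (x : 'I_m -> K -> R) :
  (0 < #|K|)%N -> (forall v, \sum_c x v c = 1) ->
  \sum_(e : edge (complete_graph m))
      (#|K|%:R^-1 - \sum_c x (src e) c * x (tgt e) c)
    <= \sum_v (\sum_c x v c ^+ 2 - #|K|%:R^-1) / 2.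
Proof.
move=> K0 x1; set k : R := #|K|%:R.
have k0 : 0 < k by rewrite ltr0n.
pose F u v := k^-1 - \sum_c x u c * x v c.
have Fsym u v : F u v = F v u.
  by congr (_ - _); apply: eq_bigr => c _; rewrite mulrC.
have := sum_complete_edge Fsym; rewrite -/k.
rewrite /F; set E := \sum_(e : edge _) _ => h.
have : \sum_u \sum_v (k^-1 - \sum_c x u c * x v c) <= 0.
  pose S c := \sum_u x u c.
  have SS : \sum_c S c = m%:R.
    by rewrite exchange_big /= (eq_bigr (fun=> 1)) // sumr_const card_ord.
  have -> : \sum_u \sum_v (k^-1 - \sum_c x u c * x v c)
      = m%:R ^+ 2 / k - \sum_c S c ^+ 2.
    under eq_bigr do rewrite sumrB sumr_const card_ord exchange_big /=.
    rewrite sumrB sumr_const card_ord exchange_big /=; congr (_ - _).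
      by rewrite -mulrnA -[LHS]mulr_natl natrM expr2.
    apply: eq_bigr => c _; rewrite expr2 mulr_suml; apply: eq_bigr => u _.
    by rewrite mulr_sumr.
  have : 0 <= \sum_c (S c - m%:R / k) ^+ 2 by apply: sumr_ge0 => c _; exact: sqr_ge0.
  under eq_bigr do rewrite sqrrB.
  rewrite big_split /= sumrB sumr_const -/k sumrMnl -mulr_suml SS.
  rewrite -[(_ ^+ 2) *+ _]mulr_natr -/k.
  suff -> : m%:R * (m%:R / k) *+ 2 = 2 * (m%:R ^+ 2 / k) :> R.
    have -> : (m%:R / k) ^+ 2 * k = m%:R ^+ 2 / k by field; lra.
    by lra.
  by ring.
rewrite -h -mulr_suml => h2.
rewrite ler_pdivlMr //.
have -> : \sum_v (\sum_c x v c ^+ 2 - k^-1) = - \sum_u (k^-1 - \sum_c x u c * x u c).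
  rewrite -sumrN; apply: eq_bigr => u _; rewrite opprB; congr (_ - _).
have := h2; rewrite -mulr_natr; lra.
Qed.

Lemma lift_prob_colourable_complete_le (R : realType) (k m n : nat) :
  (3 <= k)%N -> (0 < n)%N ->
  lift_prob R (complete_graph m) n (colourable k) <=
    ((expR 1 * n.+1%:R) ^+ k * (1 - k%:R^-1) ^+ n) ^+ #|edge (complete_graph m)|
    * (k%:R ^+ n * n.+1%:R ^+ k) ^+ m.
Proof.
move=> k3 n0.
have n0' : (0 < #|'I_n|)%N by rewrite card_ord.
have k3' : (3 <= #|'I_k|)%N by rewrite card_ord.
have kr3 : 3 <= k%:R :> R by rewrite ler_nat.
apply: le_trans (lift_prob_colourable_le R _ _ _) _.
set P := _ * _ ^+ n.
have P0 : 0 <= P.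
  rewrite mulr_ge0 ?exprn_ge0 ?mulr_ge0 ?expR_ge0 // subr_ge0 invf_le1; lra.
(* Bound for the contribution of one vertex. Once the summand is a product of such factors, the sum
   over [A] becomes a product over the vertices. *)
pose g (a : {ffun 'I_n -> 'I_k}) : R :=
  \prod_c (k%:R * frequency R a c) ^+ class_size a c.
have -> : (k%:R ^+ n * n.+1%:R ^+ k) ^+ m = \prod_(v < m) (k%:R ^+ n * n.+1%:R ^+ k : R).
  by rewrite prodr_const card_ord.
apply: (@le_trans _ _ (P ^+ #|edge (complete_graph m)| *
    \prod_(v < m) \sum_a g a)); last first.
  rewrite ler_wpM2l ?exprn_ge0 //; apply: ler_prod => v _; apply/andP; split.
    by apply: sumr_ge0 => a _; apply: prodr_ge0 => c _;
       rewrite exprn_ge0 // mulr_ge0 // divr_ge0.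
  by have := sum_prod_frequency_le R 'I_k n0'; rewrite !card_ord.
rewrite bigA_distr_bigA mulr_sumr; apply: ler_sum => A _.
apply: (@le_trans _ _ (\prod_(e : edge (complete_graph m)) (P *
   expR (n%:R * (k%:R / (k%:R - 1)) * (k%:R^-1 -
     \sum_c frequency R (A (src e)) c * frequency R (A (tgt e)) c))))).
  apply: ler_prod => e _; rewrite divr_ge0 //=.
  have := card_proper_perm_le R (A (src e)) (A (tgt e)) (ltnW k3') n0'.
  by rewrite !card_ord.
rewrite big_split /= prodr_const ler_wpM2l ?exprn_ge0 //.
rewrite -expR_sum -mulr_sumr.
apply: (@le_trans _ _ (expR (n%:R * (k%:R / (k%:R - 1)) *
  \sum_v (\sum_c frequency R (A v) c ^+ 2 - k%:R^-1) / 2))).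
  rewrite ler_expR ler_wpM2l //.
    by rewrite mulr_ge0 // divr_ge0 //; lra.
  have := @sum_edge_disagreement_le R m 'I_k (fun v => frequency R (A v)) (ltnW (ltnW k3')).
  by rewrite card_ord; apply => v; exact: sum_frequency.
rewrite mulr_sumr expR_sum; apply: ler_prod => v _; rewrite expR_ge0 /=.
have := expR_frequency_le R (A v) k3' n0'; rewrite !card_ord; apply: le_trans.
rewrite ler_expR le_eqVlt; apply/orP; left; apply/eqP; field.
by apply/andP; split; lra.
Qed.

(** * Limits and the first moment method for at least three colours *)

Local Open Scope classical_set_scope.

Lemma cvg_poly_geometric (R : realType) (D : nat) (r : R) : 0 < r < 1 ->
  n.+1%:R ^+ D * r ^+ n @[n --> \oo] --> (0 : R).
Proof.
move=> /andP[r0 r1].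
have lr : ln r < 0 by rewrite ln_lt0 // r0.
(* [e <= 1] starts the induction for [e (n+1) <= (1+e)^n], and [e (D+1) <= - ln r] makes
   [q = (1+e)^D r] smaller than 1. The sequence is then at most [e^-D q^n]. *)
pose e : R := Num.min 1 (- ln r / D.+1%:R).
have e0 : 0 < e by rewrite lt_min ltr01 divr_gt0 // oppr_gt0.
have e1 : e <= 1 by rewrite ge_min lexx.
have eD : e * D.+1%:R <= - ln r by rewrite -ler_pdivlMr // ge_min lexx orbT.
pose q := (1 + e) ^+ D * r.
have q0 : 0 < q by rewrite mulr_gt0 // exprn_gt0 // addr_gt0.
have q1 : q < 1.
  apply: (@le_lt_trans _ _ (expR (e * D%:R + ln r))).
    rewrite expRD lnK // ler_pM2r //.
    rewrite mulrC expRM_natl; apply: lerXn2r; rewrite ?nnegrE ?expR_ge0 //.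
      by rewrite addr_ge0 // ltW.
    exact: expR_ge1Dx.
  rewrite -[ltRHS]expR0 ltr_expR; move: eD; rewrite -natr1 mulrDr mulr1; lra.
apply: (@squeeze_cvgr _ _ _ _ (fun=> 0) (fun n => e^-1 ^+ D * q ^+ n)).
- apply: nearW => n; rewrite mulr_ge0 ?exprn_ge0 ?(ltW r0) //=.
  rewrite exprMn -exprM mulnC exprM mulrA -exprMn ler_wpM2r ?exprn_ge0 ?(ltW r0) //.
  apply: lerXn2r; rewrite ?nnegrE // ?mulr_ge0 ?invr_ge0 ?exprn_ge0 ?addr_ge0 ?(ltW e0) //.
  rewrite ler_pdivlMl //.
  elim: n => [|n IHn]; first by rewrite mulr1 expr0.
  rewrite exprS -natr1 mulrDr mulr1 mulrDl mul1r lerD //.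
  rewrite ler_peMr ?(ltW e0) // exprn_ege1 // lerDl ltW //.
- exact: cvg_cst.
- rewrite -(mulr0 (e^-1 ^+ D)); apply: cvgMl_tmp.
  by apply: cvg_expr; rewrite gtr0_norm.
Qed.

Lemma aas_lift_negb (R : realType) (G : multigraph) (P : pred multigraph) :
  lift_prob R G n P @[n --> \oo] --> (0 : R) -> aas_lift R G (fun L => ~~ P L).
Proof.
move=> h; rewrite /aas_lift.
have -> : (fun n => lift_prob R G n (fun L => ~~ P L)) = (fun n => 1 - lift_prob R G n P).
  apply/funext => n; rewrite /lift_prob.
  have f0 : #|matchings G n|%:R != 0 :> R.
    by rewrite pnatr_eq0 -lt0n card_matchings expn_gt0 fact_gt0.
  apply: (mulIf f0); rewrite mulrBl !mulfVK // mul1r; apply/eqP.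
  rewrite -subr_eq opprK eq_sym -natrD eqr_nat addnC.
  by rewrite -(cardC [pred s : matchings G n | P (lift_graph s)]); apply/eqP; congr (_ + _)%N;
     apply: eq_card.
rewrite -[X in _ --> X](subr0 (1 : R)).
by apply: cvgB => //; exact: cvg_cst.
Qed.

Lemma aas_lift_complete_ncolourable (R : realType) (k d : nat) :
  (3 <= k)%N -> 2 * ln k%:R < d%:R * (ln k%:R - ln (k%:R - 1)) :> R ->
  aas_lift R (complete_graph d.+1) (fun L => ~~ colourable k L).
Proof.
move=> k3 hd; apply: aas_lift_negb.
have kr3 : 3 <= k%:R :> R by rewrite ler_nat.
set G := complete_graph d.+1; pose E := #|edge G|.
have E2 : E%:R * 2 = d.+1%:R * d%:R :> R.
  have := card_complete_edge d.+1; rewrite -/G -/E => h.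
  by rewrite -!natrM; congr (_%:R); lia.
(* Exponential growth rate of the first moment bound. As [E = d (d+1) / 2], its logarithm is
   [(d+1)/2 * (2 ln k - d (ln k - ln (k-1)))], negative by hypothesis. *)
pose r : R := (1 - k%:R^-1) ^+ E * k%:R ^+ d.+1.
have q0 : 0 < 1 - k%:R^-1 :> R by rewrite subr_gt0 invf_lt1; lra.
have r0 : 0 < r by rewrite mulr_gt0 // exprn_gt0 //; lra.
have r1 : r < 1.
  rewrite -(lnK r0) -[ltRHS]expR0 ltr_expR lnM ?posrE ?exprn_gt0 //; try lra.
  rewrite !lnXn //; last by lra.
  have -> : 1 - k%:R^-1 = (k%:R - 1) / k%:R :> R by field; lra.
  rewrite ln_div ?posrE; try lra.
  rewrite -[(_ - _) *+ E]mulr_natl -[_ *+ d.+1]mulr_natl.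
  have d0 : 0 < d.+1%:R :> R by [].
  have := hd; rewrite -(ltr_pM2l d0) => h.
  nra.
apply: (@squeeze_cvgr _ _ _ _ (fun=> 0)
   (fun n => expR 1 ^+ (k * E) * (n.+1%:R ^+ (k * E + k * d.+1) * r ^+ n))).
- near=> n; apply/andP; split; first by rewrite divr_ge0.
  have n0 : (0 < n)%N by near: n; exact: nbhs_infty_gt.
  apply: le_trans (lift_prob_colourable_complete_le R _ k3 n0) _.
  rewrite -/G -/E le_eqVlt; apply/orP; left; apply/eqP.
  rewrite /r !exprMn -!exprM exprD (mulnC n E) (mulnC n d.+1).
  by ring.
- exact: cvg_cst.
- rewrite -(mulr0 (expR 1 ^+ (k * E))); apply: cvgMl_tmp.
  by apply: cvg_poly_geometric; rewrite r0.
Unshelve. all: by end_near.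
Qed.

Local Close Scope classical_set_scope.

(** * Two colours: the holonomy of a triangle *)

Lemma lift_prob_colourable2_le (R : realType) (m n : nat) :
  lift_prob R (complete_graph m.+3) n (colourable 2) <=
    #|[set p : 'S_n | reverses_cut finset.setT p]|%:R / (n`!)%:R.
Proof.
set G := complete_graph m.+3.
set X := [set p : 'S_n | _].
pose o0 : 'I_m.+3 := @Ordinal m.+3 0 isT.
pose o1 : 'I_m.+3 := @Ordinal m.+3 1 isT.
pose o2 : 'I_m.+3 := @Ordinal m.+3 2 isT.
pose e01 : edge G := exist _ (o0, o1) isT.
pose e12 : edge G := exist _ (o1, o2) isT.
pose e02 : edge G := exist _ (o0, o2) isT.
(* The walk from fibre 0 through fibres 1 and 2 back to fibre 0. Replacing the matching on [e01] by
   [p s] is injective on matchings, so [p s] is uniform and independent of the other matchings. *)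
pose p (s : matchings G n) := (s e01 * s e12 * (s e02)^-1)%g.
pose f (s : matchings G n) : matchings G n := [ffun e => if e == e01 then p s else s e].
have f_inj : injective f.
  move=> s t /ffunP st.
  have h e : e != e01 -> s e = t e by move=> ne; have := st e; rewrite !ffunE (negbTE ne).
  have := st e01; rewrite !ffunE eqxx /p -!mulgA !(h e12) // !(h e02) // => /mulIg h01.
  by apply/ffunP => e; have [->|] := eqVneq e e01; [exact: h01 | exact: h].
pose F (e : edge G) : pred 'S_n := if e == e01 then [in X] else predT.
have le : (#|[pred s : matchings G n | colourable 2 (lift_graph s)]|
    <= #|(family F : {pred matchings G n})|)%N.
  rewrite -[leqLHS](card_imset _ f_inj); apply: subset_leq_card.
  apply/fintype.subsetP => u /imsetP[s].
  rewrite inE => /colourable_liftP[A hA] ->.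
  (* The walk crosses three edges and so changes colour three times: with two colours, [i] and
     [p s i] lie on opposite sides of the cut. *)
  apply/familyP => e; rewrite ffunE /F; case: eqP => // _.
  rewrite inE; apply/reverses_cutP; exists [set i | A o0 i == ord0] => i _.
  rewrite !inE.
  have := hA e01 i; have := hA e12 (s e01 i); have := hA e02 (p s i).
  rewrite /= {2}/p !permM permKV.
  move: (A o0 i) (A o0 (_ (s e12 _))) (A o1 _) (A o2 _).
  by do 4 case=> [[|[|? //]] ?].
have f0 : 0 < (#|matchings G n|)%:R :> R.
  by rewrite ltr0n card_matchings expn_gt0 fact_gt0.
rewrite /lift_prob ler_pdivrMr // card_matchings.
apply: (@le_trans _ _ (#|(family F : {pred matchings G n})|%:R)); first by rewrite ler_nat.
rewrite card_family foldrE big_map big_enum /= (bigD1 e01) //= /F eqxx.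
rewrite (eq_bigr (fun=> n`!)); last first.
  by move=> e /negbTE->; rewrite card_Sn.
have -> : (n`! ^ #|edge G| = n`! * \prod_(e : edge G | e != e01) n`!)%N.
  by rewrite -[RHS](bigD1 e01 (F := fun=> n`!) (P := xpredT)) //= prod_nat_const.
by rewrite !natrM mulrA mulfVK // pnatr_eq0 -lt0n fact_gt0.
Qed.

Lemma aas_lift_complete_n2colourable (R : realType) (m : nat) :
  aas_lift R (complete_graph m.+3) (fun L => ~~ colourable 2 L).
Proof.
apply: aas_lift_negb.
apply: (@squeeze_cvgr _ _ _ _ (fun=> 0) (fun n => Num.sqrt (n.+1%:R^-1))).
- apply: nearW => n; apply/andP; split; first by rewrite divr_ge0.
  apply: le_trans (lift_prob_colourable2_le R _ _) _.
  have f0 : 0 < (n`!)%:R :> R by rewrite ltr0n fact_gt0.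
  set a := #|_|%N.
  have ha : (a ^ 2 * n.+1 <= n`! ^ 2)%N.
    have := card_reverses_cut (finset.setT : {set 'I_n}); rewrite cardsT card_ord.
    rewrite (_ : [set p | _ & _] = [set p : 'S_n | reverses_cut finset.setT p]) //.
    apply/setP => s; rewrite !inE andb_idl // => _.
    by apply/fintype.subsetP => x; rewrite inE.
  rewrite -[leLHS]ger0_norm ?divr_ge0 // -sqrtr_sqr ler_wsqrtr //.
  rewrite exprMn exprVn ler_pdivrMr ?exprn_gt0 // ler_pdivlMl // mulrC.
  by rewrite -!natrX -natrM ler_nat.
- exact: cvg_cst.
- rewrite -[X in (_ --> X)%classic]sqrtr0.
  apply: (cvg_comp _ _ (@cvg_harmonic R)).
  exact: sqrt_continuous.
Qed.

(* Equality [d = u_k] forces [k ^ d = k ^ 2 * (k - 1) ^ d], so [k - 1] would be a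
   divisor of [k ^ d] coprime to it. *)
Lemma u_threshold_neq_nat (R : realType) (k d : nat) : (3 <= k)%N ->
  2 * ln k%:R != d%:R * (ln k%:R - ln (k%:R - 1)) :> R.
Proof.
(* From here on [k] is one less than the number of colours. *)
case: k => [|k] // k2; rewrite -[k.+1%:R]natr1 addrK natr1; apply/eqP => e.
have kp : 0 < k%:R :> R by rewrite ltr0n; lia.
have k1p : 0 < k.+1%:R :> R by [].
have : ln ((k.+1 ^ 2 * k ^ d)%N%:R) = ln ((k.+1 ^ d)%N%:R) :> R.
  rewrite natrM !natrX lnM ?posrE ?exprn_gt0 // !lnXn //.
  rewrite -[ln _ *+ 2]mulr_natl -[ln k%:R *+ _]mulr_natl -[ln _ *+ d]mulr_natl.
  by rewrite e mulrBr subrK.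
move=> /(congr1 (@expR R)); rewrite !lnK ?posrE ?ltr0n ?muln_gt0 ?expn_gt0 //; last first.
  by apply/andP; split => //; apply/orP; left; lia.
move=> /eqP; rewrite eqr_nat => /eqP.
case: d {e} => [|d]; first by rewrite !expn0 muln1; nia.
move=> e.
have kd : (k %| k.+1 ^ d.+1)%N by rewrite -e dvdn_mull // dvdn_exp.
have := coprimeXr d.+1 (coprimenS k).
by rewrite /coprime (gcdn_idPl kd) => /eqP k1; rewrite k1 in k2.
Qed.
Unset Implicit Arguments.

Theorem theorem1p1 (R : realType) (k : nat) (hk : (2 <= k)%N) :
  u_threshold R k < (2 * k%:R - 1) * ln k%:R /\
  (forall d : nat, u_threshold R k <= d%:R ->
     aas_lift R (complete_graph d.+1) (fun L => ~~ colourable k L)).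
Proof.
have k2 : 2 <= k%:R :> R by rewrite ler_nat.
have lk : 0 < ln k%:R :> R by rewrite ln_gt0 //; lra.
(* [ln_gt_ratio] at [y = k / (k-1)], where [2 (y-1) / (y+1) = 2 / (2k-1)]. *)
have gap : 2 / (2 * k%:R - 1) < ln k%:R - ln (k%:R - 1) :> R.
  have y1 : 1 < k%:R / (k%:R - 1) :> R by rewrite ltr_pdivlMr; lra.
  have := ln_gt_ratio y1; rewrite ln_div ?posrE; [|lra..].
  by apply: le_lt_trans; rewrite le_eqVlt; apply/orP; left; apply/eqP; field;
     apply/andP; split; lra.
have gap0 : 0 < ln k%:R - ln (k%:R - 1) :> R.
  by apply: lt_trans gap; rewrite divr_gt0 //; lra.
split.
  rewrite /u_threshold ltr_pdivrMr // mulrAC ltr_pM2r //.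
  by rewrite [ltRHS]mulrC -ltr_pdivrMr //; lra.
move=> d; rewrite /u_threshold ler_pdivrMr // => hd.
move: hk; rewrite leq_eqVlt => /orP[/eqP ke|k3].
  (* Since [ln 1 = 0], the threshold is 2, so [K_{d+1}] contains a triangle. *)
  move: hd; rewrite -ke (_ : 2 - 1 = 1 :> R); last by lra.
  rewrite ln1 subr0 ler_pM2r; last by rewrite ln_gt0 // ltr1n.
  rewrite ler_nat; case: d => [|[|d]] // _.
  exact: aas_lift_complete_n2colourable.
apply: aas_lift_complete_ncolourable => //.
by rewrite lt_neqAle u_threshold_neq_nat.
Qed.
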